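(* Let $G$ be a $2$-self-centered graph of girth $5$. Then there are non-negative integers $r,s$ and a graph $X$ which has an SBIC via $(\mathbb{A}_r,\mathbb{B}_s)$ (for some families $\mathbb{A}_r=\{A_1,\dots,A_r\}$ and $\mathbb{B}_s=\{B_1,\dots,B_s\}$ of subsets of $V(X)$) such that $G=GCB_X(1,1,\mathbb{A}_r,\mathbb{B}_s)$.
   Context: All graphs are finite and simple. A graph is $2$-self-centered if its diameter and its radius (maximum and minimum eccentricity) are both $2$. $u\sim v$ means $u$ and $v$ are adjacent. $d_X(u,v)$ is the distance in $X$ ($\infty$ if there is no path), and $d_X(u,S)=\min\{d_X(u,v): v\in S\}$ for $S\subseteq V(X)$ ($\infty$ if $S=\emptyset$). The graph $X$ below may have empty vertex set. Equality $G=GCB_X(\dots)$ is understood up to isomorphism. **SBIC.** A graph $X$ has a specialized bi-independent covering via $(\mathbb{A}_r,\mathbb{B}_s)$ (an SBIC via $(\mathbb{A}_r,\mathbb{B}_s)$) if: (i) $X$ is triangle-free. (ii) $\mathbb{A}_r=\{A_1,\dots,A_r\}$ and $\mathbb{B}_s=\{B_1,\dots,B_s\}$ are two (indexed) families of not necessarily distinct independent sets of $X$ such that $V(X)=\bigcup_{i=1}^r A_i=\bigcup_{j=1}^s B_j$. (iii) For all $u,v\in V(X)$, if $d_X(u,v)\ge 3$, then there is $1\le i\le r$ with $u,v\in A_i$ or there is $1\le j\le s$ with $u,v\in B_j$. (iv) For all $u\in V(X)$ and $i\in\{1,\dots,r\}$, if $d_X(u,A_i)\ge 2$, then there is $j\in\{1,\dots,s\}$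 such that $A_i\cap B_j=\emptyset$ and $u\in B_j$. (v) For all $u\in V(X)$ and $j\in\{1,\dots,s\}$, if $d_X(u,B_j)\ge 2$, then there is $i\in\{1,\dots,r\}$ such that $A_i\cap B_j=\emptyset$ and $u\in A_i$. **$X$-generalized complete bipartite graph.** A graph $G$ is $X$-generalized complete bipartite, denoted $GCB_X(k,\ell,\mathbb{A}_r,\mathbb{B}_s)$ with $k,\ell,r,s\ge 0$, if $X$ has an SBIC via $(\mathbb{A}_r,\mathbb{B}_s)$ and $G$ is constructed as follows (the only edges of $G$ are those listed in (1)--(6)): (1) $V(G)=K\cup L\cup Y\cup Z\cup V(X)$ (disjoint union), where $|K|=k$, $|L|=\ell$, $Y=\{y_1,\dots,y_r\}$ with $|Y|=r$, $Z=\{z_1,\dots,z_s\}$ with $|Z|=s$; moreover $E(X)\subseteq E(G)$. (2) $a\sim t$ for all $a\in K$ and $t\in L\cup Y$. (3) $b\sim t$ for all $b\in L$ and $t\in K\cup Z$. (4) $y_i\sim t$ for all $t\in A_i$ and $1\le i\le r$. (5) $z_j\sim t$ for all $t\in B_j$ and $1\le j\le s$. (6) $y_i\sim z_j$ if and only if $A_i\cap B_j=\emptyset$. In addition the following conditions are required: (7) If $k=0$ and $\ell\ne 0$, then every member of $Y$ has a neighbor in $Z$; moreover, for all $i\ne j$ in $\{1,\dots,r\}$, we have $A_i\cap A_j\ne\emptyset$ or there is $p\in\{1,\dots,s\}$ such that $A_i\cap B_p=A_j\cap B_p=\emptyset$. (8) If $k\ne 0$ and $\ell=0$, then every member of $Z$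 has a neighbor in $Y$; moreover, for all $i\ne j$ in $\{1,\dots,s\}$, we have $B_i\cap B_j\ne\emptyset$ or there is $q\in\{1,\dots,r\}$ such that $B_i\cap A_q=B_j\cap A_q=\emptyset$. (9) If $k=\ell=0$, then $r,s\ge 1$; for all $i\ne j$ in $\{1,\dots,r\}$, we have $A_i\cap A_j\neq\emptyset$ or there is $p\in\{1,\dots,s\}$ such that $A_i\cap B_p=A_j\cap B_p=\emptyset$; and for all $i\ne j$ in $\{1,\dots,s\}$, we have $B_i\cap B_j\neq\emptyset$ or there is $q\in\{1,\dots,r\}$ such that $B_i\cap A_q=B_j\cap A_q=\emptyset$. (10) $r=s=0$ if and only if $V(X)=\emptyset$ and $k,\ell\ge 2$. (11) If $|V(X)|=1$, then $k$ and $\ell$ are non-zero. Convention: either $r=s=0$ and $V(X)=\emptyset$, or $r,s\ge 1$ and $V(X)\ne\emptyset$. *)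

(* Defs.v *)
From mathcomp Require Import all_boot.

Set Implicit Arguments.
Unset Strict Implicit.
Unset Printing Implicit Defensive.

(* None is +oo. *)
Definition enat := option nat.

Definition ele (m n : enat) : bool :=
  match m, n with
  | _, None => true
  | None, Some _ => false
  | Some a, Some b => a <= b
  end.

Definition emin (m n : enat) : enat := if ele m n then m else n.
Definition emax (m n : enat) : enat := if ele m n then n else m.

Record sgraph := SGraph {
  svertex :> finType;
  sedge : rel svertex;
  sedge_sym : symmetric sedge;
  sedge_irrefl : irreflexive sedge
}.

Definition sg_iso (G H : sgraph) : Prop :=
  exists2 f : G -> H, bijective f
    & forall u v : G, sedge (f u) (f v) = sedge u v.

Section Graph.
Variable X : sgraph.
Implicit Types (u v w : X) (S : {set X}).

Definition has_walk (n : nat) u v : bool :=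
  [exists p : n.-tuple X, path (@sedge X) u p && (last u p == v)].

(* A shortest walk visits no vertex twice, so lengths below #|X| suffice. *)
Definition gdist u v : enat :=
  \big[emin/None]_(n < #|X| | has_walk n u v) Some (nat_of_ord n).

Definition gdist_set u S : enat := \big[emin/None]_(v in S) gdist u v.

Definition ecc u : enat := \big[emax/Some 0]_(v : X) gdist u v.
Definition diameter : enat := \big[emax/Some 0]_(u : X) ecc u.
Definition radius : enat := \big[emin/None]_(u : X) ecc u.

Definition self_centered (d : nat) : Prop :=
  diameter = Some d /\ radius = Some d.

Definition has_cycle (n : nat) : bool :=
  (3 <= n) && [exists c : n.-tuple X, ucycleb (@sedge X) c].

Definition girth : enat :=
  \big[emin/None]_(n < #|X|.+1 | has_cycle n) Some (nat_of_ord n).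

Definition triangle_free : Prop :=
  forall u v w, sedge u v -> sedge v w -> ~~ sedge u w.

Definition independent S : Prop :=
  forall u v, u \in S -> v \in S -> ~~ sedge u v.

End Graph.

Record SBIC (X : sgraph) (r s : nat)
    (A : 'I_r -> {set X}) (B : 'I_s -> {set X}) : Prop := {
  sbic_triangle_free : triangle_free X;
  sbic_indepA : forall i, independent (A i);
  sbic_indepB : forall j, independent (B j);
  sbic_coverA : \bigcup_i A i = [set: X];
  sbic_coverB : \bigcup_j B j = [set: X];
  sbic_far : forall u v : X, ele (Some 3) (gdist u v) ->
    (exists i, u \in A i /\ v \in A i) \/ (exists j, u \in B j /\ v \in B j);
  sbic_farA : forall (u : X) (i : 'I_r), ele (Some 2) (gdist_set u (A i)) ->
    exists j, A i :&: B j = set0 /\ u \in B j;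
  sbic_farB : forall (u : X) (j : 'I_s), ele (Some 2) (gdist_set u (B j)) ->
    exists i, A i :&: B j = set0 /\ u \in A i
}.

Section GCB.
Variables (k l : nat) (X : sgraph) (r s : nat).
Variables (A : 'I_r -> {set X}) (B : 'I_s -> {set X}).

Definition gcb_vertex : finType := (('I_k + 'I_l) + ('I_r + 'I_s) + X)%type.

Local Notation vK a := (inl (inl (inl a))).
Local Notation vL b := (inl (inl (inr b))).
Local Notation vY i := (inl (inr (inl i))).
Local Notation vZ j := (inl (inr (inr j))).
Local Notation vX x := (inr x).

Definition gcb_arc (u v : gcb_vertex) : bool :=
  match u, v with
  | vK _, vL _ => true
  | vK _, vY _ => true
  | vL _, vZ _ => true
  | vY i, vX x => x \in A i
  | vZ j, vX x => x \in B j
  | vY i, vZ j => A i :&: B j == set0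
  | vX x, vX y => sedge x y
  | _, _ => false
  end.

Definition gcb_edge (u v : gcb_vertex) : bool := gcb_arc u v || gcb_arc v u.

Lemma gcb_edge_sym : symmetric gcb_edge.
Proof. by move=> u v; rewrite /gcb_edge orbC. Qed.

Lemma gcb_edge_irrefl : irreflexive gcb_edge.
Proof.
rewrite /gcb_edge => u; rewrite orbb.
by case: u => [[[a|b]|[i|j]]|x] //=; apply: sedge_irrefl.
Qed.

Definition gcb_graph : sgraph := SGraph gcb_edge_sym gcb_edge_irrefl.

Definition Y_has_Z_nbr : Prop :=
  forall i : 'I_r, exists j : 'I_s, gcb_edge (vY i) (vZ j).

Definition Z_has_Y_nbr : Prop :=
  forall j : 'I_s, exists i : 'I_r, gcb_edge (vZ j) (vY i).

Definition Y_linked : Prop :=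
  forall i j : 'I_r, i != j -> A i :&: A j <> set0 \/
    exists p : 'I_s, A i :&: B p = set0 /\ A j :&: B p = set0.

Definition Z_linked : Prop :=
  forall i j : 'I_s, i != j -> B i :&: B j <> set0 \/
    exists q : 'I_r, B i :&: A q = set0 /\ B j :&: A q = set0.

Record GCB_conditions : Prop := {
  gcb_k0 : k = 0 -> l <> 0 -> Y_has_Z_nbr /\ Y_linked;
  gcb_l0 : k <> 0 -> l = 0 -> Z_has_Y_nbr /\ Z_linked;
  gcb_kl0 : k = 0 -> l = 0 -> [/\ 1 <= r, 1 <= s, Y_linked & Z_linked];
  gcb_rs0 : (r = 0 /\ s = 0) <-> [/\ #|X| = 0, 2 <= k & 2 <= l];
  gcb_X1 : #|X| = 1 -> k <> 0 /\ l <> 0;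
  gcb_convention : [/\ r = 0, s = 0 & #|X| = 0] \/
                   [/\ 1 <= r, 1 <= s & #|X| <> 0]
}.

End GCB.

Definition is_GCB (G : sgraph) (k l : nat) (X : sgraph) (r s : nat)
    (A : 'I_r -> {set X}) (B : 'I_s -> {set X}) : Prop :=
  [/\ SBIC A B, GCB_conditions k l A B & sg_iso G (gcb_graph k l A B)].

(* Main.v *)
Require Import Defs.
From mathcomp Require Import all_boot.

Set Implicit Arguments.
Unset Strict Implicit.
Unset Printing Implicit Defensive.

(** Any edge [ab] lying on a 5-cycle works: take [K = {a}], [L = {b}],
    [Y = N(a) \ {b}], [Z = N(b) \ {a}] and let [X] be induced on the remaining
    vertices. All these sets are disjoint because [G] is triangle-free. Each
    condition asking for a common neighbour is met because two nonadjacent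
    vertices of [G] have one, and triangle-freeness locates it. The 5-cycle
    makes [Y], [Z] and [X] nonempty. *)

(** * Comparing extended naturals with a finite bound *)

Lemma ele_succ (m : nat) (x : enat) :
  ele (Some m.+1) x = ~~ ele x (Some m).
Proof. by case: x => [n|] //=; rewrite -ltnNge. Qed.

Lemma ele_emin (m : nat) :
  {morph (fun x => ele x (Some m)) : x y / emin x y >-> x || y}.
Proof.
move=> [x|] [y|] //=; rewrite /emin /=; last by rewrite orbF.
case: leqP => [le_xy|/ltnW le_yx] /=; apply/idP/orP; auto; case=> //.
  exact: leq_trans.
exact: leq_trans.
Qed.

Lemma ele_emax (m : nat) :
  {morph (fun x => ele x (Some m)) : x y / emax x y >-> x && y}.
Proof.
move=> [x|] [y|] //=; rewrite /emax /=; last by rewrite andbF.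
case: leqP => [le_xy|/ltnW le_yx] /=; apply/idP/andP => [le_m|[]//].
  by split=> //; apply: leq_trans le_m.
by split=> //; apply: leq_trans le_m.
Qed.

(** Against a finite bound, [emin] acts as a disjunction with [None] as false, so bounds on
    distances and girth become existence statements. *)
Lemma ele_bigmin (I : finType) (P : pred I) (F : I -> enat) (m : nat) :
  ele (\big[emin/None]_(i | P i) F i) (Some m)
    = [exists (i | P i), ele (F i) (Some m)].
Proof.
have ele_None : ele None (Some m) = false by [].
by rewrite (big_morph (fun x => ele x (Some m)) (ele_emin m) ele_None) big_orE.
Qed.

Lemma ele_bigmax (I : finType) (P : pred I) (F : I -> enat) (m : nat) :
  ele (\big[emax/Some 0]_(i | P i) F i) (Some m)
    = [forall (i | P i), ele (F i) (Some m)].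
Proof.
have ele_0 : ele (Some 0) (Some m) = true by [].
by rewrite (big_morph (fun x => ele x (Some m)) (ele_emax m) ele_0) big_andE.
Qed.

(** * Short distances, diameter and girth *)

Section Metric.
Variable X : sgraph.
Implicit Types u v w : X.

Lemma sedge_neq {u v} : sedge u v -> u != v.
Proof. by apply: contraTneq => ->; rewrite sedge_irrefl. Qed.

Lemma gdist_walk m u v : ele (gdist u v) (Some m) ->
  exists2 n, n <= m & has_walk n u v.
Proof.
by rewrite ele_bigmin => /existsP[n /andP[walk_n le_nm]]; exists n.
Qed.

(** Distinctness of the [size p + 1] vertices of [u :: p] forces [size p < #|X|], the range over
    which [gdist] minimises. *)
Lemma path_gdist m u (p : seq X) : path (@sedge X) u p -> uniq (u :: p) ->
  size p <= m -> ele (gdist u (last u p)) (Some m).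
Proof.
move=> path_p uniq_p le_pm.
have lt_p : size p < #|X|.
  by have := max_card (mem (u :: p)); rewrite (card_uniqP uniq_p).
rewrite ele_bigmin; apply/existsP; exists (Ordinal lt_p); rewrite /= le_pm andbT.
by apply/existsP; exists (in_tuple p); rewrite /= path_p eqxx.
Qed.

Lemma gdist_le1P u v : reflect (u = v \/ sedge u v) (ele (gdist u v) (Some 1)).
Proof.
apply: (iffP idP) => [/gdist_walk[[|[|//]] _ /existsP[p /andP[]]]|[<-|uv]].
- by rewrite tuple0 => _ /eqP; left.
- by case/tupleP: p => w p; rewrite tuple0 /= andbT => ? /eqP <-; right.
- exact: (@path_gdist _ _ [::]).
- by apply: (@path_gdist _ _ [:: v]); rewrite //= ?uv // inE sedge_neq.
Qed.

Lemma gdist_le2P u v :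
  reflect [\/ u = v, sedge u v | exists2 w, sedge u w & sedge v w]
    (ele (gdist u v) (Some 2)).
Proof.
apply: (iffP idP) => [/gdist_walk[[|[|[|//]]] _ /existsP[p /andP[]]]|].
- by rewrite tuple0 => _ /eqP; constructor 1.
- case/tupleP: p => w p; rewrite tuple0 /= andbT => ? /eqP <-.
  by constructor 2.
- case/tupleP: p => w p; case/tupleP: p => t p; rewrite tuple0 /= andbT.
  by case/andP=> uw wt /eqP <-; constructor 3; exists w; rewrite // sedge_sym.
(* The walk through [w] repeats a vertex when [u = v], so equality is settled first. *)
have [<- _|neq_uv] := eqVneq u v; first exact: (@path_gdist _ _ [::]).
case=> [/eqP|uv|[w uw vw]]; first by rewrite (negPf neq_uv).
  by apply: (@path_gdist _ _ [:: v]); rewrite //= ?uv // inE neq_uv.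
apply: (@path_gdist _ _ [:: w; v]) => //=; first by rewrite uw sedge_sym vw.
by rewrite !inE negb_or neq_uv (sedge_neq uw) eq_sym (sedge_neq vw).
Qed.

Lemma gdist_set_le1 u v (S : {set X}) : v \in S -> u = v \/ sedge u v ->
  ele (gdist_set u S) (Some 1).
Proof.
by move=> Sv /gdist_le1P d_uv; rewrite ele_bigmin; apply/existsP; exists v; rewrite Sv.
Qed.

Lemma diameter_le2 u v : ele (diameter X) (Some 2) ->
  u != v -> ~~ sedge u v -> exists2 w, sedge u w & sedge v w.
Proof.
rewrite ele_bigmax => /forall_inP/(_ u isT).
rewrite ele_bigmax => /forall_inP/(_ v isT)/gdist_le2P[->|->|//];
  by rewrite ?eqxx.
Qed.

Lemma girth_cycle n : girth X = Some n -> has_cycle X n.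
Proof.
move=> girth_n; have : ele (girth X) (Some n) by rewrite girth_n /=.
rewrite ele_bigmin => /existsP[i /andP[cyc_i /= le_in]].
have: i < n -> False.
  (* The girth is now [n.+1], and a cycle of length [i <= n] would bound it by [n]. *)
  case: n girth_n {le_in} => // n girth_n lt_in.
  have: ~~ ele (girth X) (Some n) by rewrite girth_n /= -ltnNge.
  rewrite ele_bigmin => /existsP[]; exists i; by rewrite cyc_i.
move=> nlt; suff -> : n = i by [].
by apply/eqP; rewrite eqn_leq le_in andbT leqNgt; apply/negP.
Qed.

Lemma girth_triangle_free : ele (Some 4) (girth X) -> triangle_free X.
Proof.
rewrite ele_succ ele_bigmin => no_cyc u v w uv vw; apply: contra no_cyc => uw.
have uniq_c : uniq [:: u; v; w].
  by rewrite /= !inE negb_or !sedge_neq.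
have lt3 : 3 < #|X|.+1.
  by have := max_card (mem [:: u; v; w]); rewrite (card_uniqP uniq_c).
apply/existsP; exists (Ordinal lt3); rewrite /= andbT.
by apply/existsP; exists [tuple u; v; w];
  rewrite /ucycleb uniq_c /= uv vw sedge_sym uw.
Qed.

End Metric.

(** * Common neighbours around an edge *)

Section EdgeNeighbourhood.
Variable G : sgraph.
Hypotheses (tfG : triangle_free G) (diamG : ele (diameter G) (Some 2)).
Implicit Types a b u v w : G.

Definition private_nbrs a b : {set G} := [set x | sedge a x & x != b].

Definition remote a b : pred G :=
  [pred x | [&& x != a, x != b, ~~ sedge a x & ~~ sedge b x]].

(** This symmetry lets facts proved on the [a] side be reused on the [b] side. *)
Lemma remoteC a b x : remote a b x = remote b a x.
Proof. by rewrite /remote /= andbCA [~~ sedge a x && _]andbC. Qed.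

Lemma vertex_cases a b w :
  [|| w == a, w == b, w \in private_nbrs a b, w \in private_nbrs b a
    | remote a b w].
Proof.
rewrite /remote !inE /=; case: (w == a); case: (w == b) => //=.
by case: (sedge a w); case: (sedge b w).
Qed.

Lemma remote_covered a b u : sedge a b -> remote a b u ->
  exists2 y, y \in private_nbrs a b & sedge y u.
Proof.
move=> ab /and4P[ua ub au bu].
have [|y ay uy] := diameter_le2 diamG _ au; first by rewrite eq_sym.
exists y; last by rewrite sedge_sym.
by rewrite inE ay; apply: contraNneq bu => <-; rewrite sedge_sym.
Qed.

Lemma private_not_adj a b y : sedge a b -> y \in private_nbrs a b ->
  ~~ sedge b y.
Proof.
rewrite inE => ab /andP[ay _]; rewrite sedge_sym.
by apply: contraTN ab => yb; apply: tfG ay yb.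
Qed.

(** A common neighbour [w] of [y] and [u] is neither [a] nor [b], as [u] is remote, and is not
    adjacent to [a], else [a], [y], [w] form a triangle. Whether [b] is adjacent to [w] decides the
    alternative. *)
Lemma private_remote_link a b y u : sedge a b -> y \in private_nbrs a b ->
  remote a b u -> ~~ sedge y u ->
  exists w, [/\ sedge y w, sedge u w & remote a b w || (w \in private_nbrs b a)].
Proof.
move=> ab Yy remu; have nby := private_not_adj ab Yy.
move: Yy (remu); rewrite inE => /andP[ay yb] /and4P[ua ub au bu] nyu.
have [|w yw uw] := diameter_le2 diamG _ nyu.
  by apply: contraNneq au => <-.
exists w; split=> //; have aw := tfG ay yw.
have wa : w != a by apply: contraNneq au => <-; rewrite sedge_sym.
have wb : w != b by apply: contraNneq bu => <-; rewrite sedge_sym.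
by rewrite /remote !inE /= wa wb aw /= andbT orNb.
Qed.

(** A common neighbour of [y] and [z] avoids the neighbourhoods of [a] and [b] by triangle-freeness;
    it is not [a] or [b], since [z] misses [a] and [y] misses [b]. *)
Lemma private_private_link a b y z : sedge a b ->
  y \in private_nbrs a b -> z \in private_nbrs b a -> ~~ sedge y z ->
  exists w, [/\ sedge y w, sedge z w & remote a b w].
Proof.
move=> ab Yy Zz nyz.
have ba : sedge b a by rewrite sedge_sym.
have nby := private_not_adj ab Yy; have naz := private_not_adj ba Zz.
move: Yy Zz; rewrite !inE => /andP[ay yb] /andP[bz za].
have [|w yw zw] := diameter_le2 diamG _ nyz.
  by apply: contraNneq naz => <-.
exists w; split=> //; rewrite /remote /= (tfG ay yw) (tfG bz zw) /=.
rewrite (contraNneq _ naz) 1?(contraNneq _ nby) // => <-; by rewrite sedge_sym.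
Qed.

End EdgeNeighbourhood.

(** * The decomposition of [G] along the edge [ab] *)

Section Decomposition.
Variables (G : sgraph) (a b : G).
Hypotheses (ab : sedge a b) (tfG : triangle_free G).
Hypothesis diamG : ele (diameter G) (Some 2).

Definition remote_edge : rel {x | remote a b x} :=
  [rel x y | sedge (val x) (val y)].

Lemma remote_edge_sym : symmetric remote_edge.
Proof. by move=> x y; apply: sedge_sym. Qed.

Lemma remote_edge_irrefl : irreflexive remote_edge.
Proof. by move=> x; apply: sedge_irrefl. Qed.

Definition remote_graph : sgraph := SGraph remote_edge_sym remote_edge_irrefl.

(** Indexing by the enumeration of [S] keeps vertices with equal traces apart. *)
Definition trace (S : {set G}) (i : 'I_#|S|) : {set remote_graph} :=
  [set x : {x | remote a b x} | sedge (enum_val i) (val x)].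

Local Notation Y := (private_nbrs a b).
Local Notation Z := (private_nbrs b a).
Local Notation A := (@trace Y).
Local Notation B := (@trace Z).

Let ba : sedge b a. Proof. by rewrite sedge_sym. Qed.

Lemma in_trace (S : {set G}) (i : 'I_#|S|) (x : remote_graph) :
  (x \in trace i) = sedge (enum_val i) (val x).
Proof. by rewrite inE. Qed.

Lemma trace_independent (S : {set G}) (i : 'I_#|S|) : independent (trace i).
Proof.
move=> u v; rewrite !in_trace => iu iv; apply: contraTN iv => uv.
exact: tfG iu uv.
Qed.

(** Nonadjacent vertices of [Y] and [Z] have a common neighbour that is remote; adjacent ones have
    none, as it would close a triangle. *)
Lemma trace_disjoint (i : 'I_#|Y|) (j : 'I_#|Z|) :
  (A i :&: B j == set0) = sedge (enum_val i) (enum_val j).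
Proof.
apply/eqP/idP => [disj|ij].
  apply: contraT => /(private_private_link tfG diamG ab (enum_valP i) (enum_valP j)).
  case=> w [iw jw rw]; suff: (exist _ w rw : remote_graph) \in A i :&: B j.
    by rewrite disj inE.
  by rewrite inE !in_trace iw jw.
apply/setP => x; rewrite inE !in_trace inE; apply/negP => /andP[ix jx].
by have := tfG ij jx; rewrite ix.
Qed.

Lemma trace_sbic : SBIC A B.
Proof.
have covA (u : remote_graph) : exists i, u \in A i.
  have [y Yy yu] := remote_covered diamG ab (valP u).
  by exists (enum_rank_in Yy y); rewrite in_trace enum_rankK_in.
have covB (u : remote_graph) : exists j, u \in B j.
  have := valP u; rewrite remoteC => /(remote_covered diamG ba)[z Zz zu].
  by exists (enum_rank_in Zz z); rewrite in_trace enum_rankK_in.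
(* Distance at least 2 from a trace means being outside it and having no neighbour in it. *)
have far (S : {set G}) (u : remote_graph) (i : 'I_#|S|) :
    ele (Some 2) (gdist_set u (trace i)) -> ~~ sedge (enum_val i) (val u)
    /\ forall w, sedge (enum_val i) w -> sedge (val u) w -> ~~ remote a b w.
  rewrite ele_succ => du; split=> [|w iw uw]; apply: contra du => h.
    by apply: (@gdist_set_le1 _ u u); [rewrite in_trace | left].
  apply: (@gdist_set_le1 _ u (exist _ w h : remote_graph)); last by right.
  by rewrite in_trace.
split=> //.
- by move=> u v w uv vw; apply: tfG uv vw.
- by move=> i; apply: trace_independent.
- by move=> j; apply: trace_independent.
- by apply/setP => u; rewrite inE; have [i ?] := covA u; apply/bigcupP; exists i.
- by apply/setP => u; rewrite inE; have [i ?] := covB u; apply/bigcupP; exists i.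
- move=> u v; rewrite ele_succ => duv.
  have [uv|neq_uv] := eqVneq u v.
    by left; have [i ui] := covA u; exists i; rewrite -uv.
  have nuv : ~~ sedge (val u) (val v).
    by apply: contra duv => uv; apply/gdist_le2P; constructor 2.
  have [|w uw vw] := diameter_le2 diamG _ nuv; first by rewrite (inj_eq val_inj).
  (* The common neighbour [w] is not [a] or [b], as [u] is remote, and not remote, as [u] and [v]
     would then be at distance at most 2 in [X]. So [w] is in [Y] or [Z], and its trace contains
     both. *)
  case/or4P: (vertex_cases a b w) => [/eqP wa|/eqP wb|Yw|/orP[Zw|rw]].
  + by case/and4P: (valP u) => _ _ /negP[]; move: uw; rewrite wa sedge_sym.
  + by case/and4P: (valP u) => _ _ _ /negP[]; move: uw; rewrite wb sedge_sym.
  + left; exists (enum_rank_in Yw w).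
    by rewrite !in_trace enum_rankK_in // !(sedge_sym w).
  + right; exists (enum_rank_in Zw w).
    by rewrite !in_trace enum_rankK_in // !(sedge_sym w).
  + case/negP: duv; apply/gdist_le2P; constructor 3.
    by exists (exist _ w rw : remote_graph).
- move=> u i /far[niu nrem].
  (* A remote link is excluded by [far], so [w] lies in [Z]: its trace contains [u], and adjacency
     to the vertex of index [i] makes the traces disjoint. *)
  have [w [iw uw /orP[rw|Zw]]] :=
    private_remote_link tfG diamG ab (enum_valP i) (valP u) niu.
    by case/negP: (nrem w iw uw).
  exists (enum_rank_in Zw w).
  split; first by apply/eqP; rewrite trace_disjoint enum_rankK_in.
  by rewrite in_trace enum_rankK_in // sedge_sym.
- move=> u j /far[nju nrem].
  have := valP u; rewrite remoteC => ru.
  have [w [jw uw /orP[rw|Yw]]] :=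
    private_remote_link tfG diamG ba (enum_valP j) ru nju.
    by case/negP: (nrem w jw uw); rewrite remoteC.
  exists (enum_rank_in Yw w).
  split; first by apply/eqP; rewrite trace_disjoint enum_rankK_in // sedge_sym.
  by rewrite in_trace enum_rankK_in // sedge_sym.
Qed.

Local Notation H := (gcb_graph 1 1 A B).

Definition gcb_embed (t : H) : G :=
  match t with
  | inl (inl (inl _)) => a
  | inl (inl (inr _)) => b
  | inl (inr (inl i)) => enum_val i
  | inl (inr (inr j)) => enum_val j
  | inr x => val x
  end.

(* The five parts have distinct tuples, so injectivity reduces to each part. *)
Lemma gcb_embed_part (t : H) :
  (gcb_embed t == a, gcb_embed t == b,
   sedge a (gcb_embed t), sedge b (gcb_embed t)) =
  match t with
  | inl (inl (inl _)) => (true, false, false, true)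
  | inl (inl (inr _)) => (false, true, true, false)
  | inl (inr (inl i)) => (false, false, true, false)
  | inl (inr (inr j)) => (false, false, false, true)
  | inr x => (false, false, false, false)
  end.
Proof.
have neq_ab := sedge_neq ab; have neq_ba := sedge_neq ba.
case: t => [[[k|l]|[i|j]]|x] /=.
- by rewrite eqxx (negPf neq_ab) sedge_irrefl ba.
- by rewrite eqxx (negPf neq_ba) sedge_irrefl ab.
- have := enum_valP i; rewrite (negPf (private_not_adj tfG ab (enum_valP i))).
  rewrite inE => /andP[ai /negPf->].
  by rewrite ai eq_sym (negPf (sedge_neq ai)).
- have := enum_valP j; rewrite (negPf (private_not_adj tfG ba (enum_valP j))).
  rewrite inE => /andP[bj /negPf->].
  by rewrite bj eq_sym (negPf (sedge_neq bj)).
- by case/and4P: (valP x) => /negPf-> /negPf-> /negPf-> /negPf->.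
Qed.

Lemma gcb_embed_inj : injective gcb_embed.
Proof.
move=> s t eq_st.
have := gcb_embed_part s; rewrite eq_st gcb_embed_part => eq_part.
case: s t eq_st eq_part => [[[k|l]|[i|j]]|x] [[[k'|l']|[i'|j']]|x'] //= eq_st _.
- by rewrite (ord1 k) (ord1 k').
- by rewrite (ord1 l) (ord1 l').
- by rewrite (enum_val_inj eq_st).
- by rewrite (enum_val_inj eq_st).
- by rewrite (val_inj eq_st).
Qed.

Lemma gcb_embed_surj x : exists t, x = gcb_embed t.
Proof.
case/or4P: (vertex_cases a b x) => [/eqP->|/eqP->|Yx|/orP[Zx|rx]].
- by exists (inl (inl (inl ord0))).
- by exists (inl (inl (inr ord0))).
- by exists (inl (inr (inl (enum_rank_in Yx x)))); rewrite /= enum_rankK_in.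
- by exists (inl (inr (inr (enum_rank_in Zx x)))); rewrite /= enum_rankK_in.
- by exists (inr (exist _ x rx)).
Qed.

Lemma gcb_embed_edge (s t : H) :
  sedge (gcb_embed s) (gcb_embed t) = sedge s t.
Proof.
(* [Y] and [Z] are independent, each lying in one neighbourhood. *)
have nbrs_indep (c d : G) (i j : 'I_#|private_nbrs c d|) :
    sedge (enum_val i) (enum_val j) = false.
  have := enum_valP i; have := enum_valP j; rewrite !inE => /andP[cj _] /andP[ci _].
  by apply/negP => ij; have := tfG ci ij; rewrite cj.
have adjY (i : 'I_#|Y|) :
    (sedge a (enum_val i) = true) * (sedge b (enum_val i) = false).
  by case: (gcb_embed_part (inl (inr (inl i)))) => _ _ -> ->.
have adjZ (j : 'I_#|Z|) :
    (sedge a (enum_val j) = false) * (sedge b (enum_val j) = true).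
  by case: (gcb_embed_part (inl (inr (inr j)))) => _ _ -> ->.
have adjX (x : remote_graph) :
    (sedge a (val x) = false) * (sedge b (val x) = false).
  by case: (gcb_embed_part (inr x)) => _ _ -> ->.
case: s t => [[[k|l]|[i|j]]|x] [[[k'|l']|[i'|j']]|x'];
  rewrite /= /gcb_edge /= ?in_trace ?trace_disjoint ?orbF ?orbb //;
  rewrite ?nbrs_indep ?sedge_irrefl ?ab ?ba ?adjY ?adjZ ?adjX ?(sedge_sym _ a)
     ?(sedge_sym _ b) ?adjY ?adjZ ?adjX //;
  last by rewrite [in RHS](remote_edge_sym x') orbb.
(* What remains are pairs whose arc is listed in the opposite orientation. *)
all: exact: sedge_sym.
Qed.

Lemma gcb_embed_iso : sg_iso G H.
Proof.
(* The isomorphism must start from [G], so [gcb_embed] is inverted; the boolean equality is what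
   [xchoose] selects on. *)
have surj x : exists t, gcb_embed t == x.
  by have [t ->] := gcb_embed_surj x; exists t.
pose f x := xchoose (surj x).
have fK : cancel f gcb_embed by move=> x; apply/eqP/(xchooseP (surj x)).
exists f => [|u v]; last by rewrite -gcb_embed_edge !fK.
by exists gcb_embed => // t; apply: gcb_embed_inj; rewrite fK.
Qed.

(** With [k = l = 1] the conditions on zero [k] or [l] hold vacuously; the witnesses make [r], [s]
    and [#|X|] nonzero, which settles [gcb_rs0] and the convention. *)
Lemma trace_gcb (x y z : G) : x \in Y -> y \in Z -> remote a b z ->
  is_GCB G 1 1 A B.
Proof.
move=> Yx Zy rz; split; [exact: trace_sbic | | exact: gcb_embed_iso].
have Y0 : 0 < #|Y| by apply/card_gt0P; exists x.
have Z0 : 0 < #|Z| by apply/card_gt0P; exists y.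
have X0 : #|remote_graph| <> 0.
  by apply/eqP; rewrite -lt0n; apply/card_gt0P; exists (exist _ z rz).
by split=> //; [split=> [[Y_eq0]|[]//]; rewrite Y_eq0 in Y0 | right].
Qed.

End Decomposition.

(** * Choosing the edge on a 5-cycle *)

Theorem proposition2 (G : sgraph) (hG : self_centered G 2)
    (hgirth : girth G = Some 5) :
  exists (r s : nat) (X : sgraph) (A : 'I_r -> {set X}) (B : 'I_s -> {set X}),
    SBIC A B /\ is_GCB G 1 1 A B.
Proof.
have tfG : triangle_free G by apply: girth_triangle_free; rewrite hgirth.
have diamG : ele (diameter G) (Some 2) by case: hG => ->.
have /andP[_ /existsP[c]] := girth_cycle hgirth.
(* The cycle is [a, b, y, z, x]: [x] lies in [Y], [y] in [Z], and the opposite vertex [z] is remote,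
   since a chord to [a] or [b] would make a triangle. *)
case/tupleP: c => a c; case/tupleP: c => b c; case/tupleP: c => y c.
case/tupleP: c => z c; case/tupleP: c => x c; rewrite tuple0 /ucycleb /=.
rewrite !inE !negb_or andbT -!andbA.
case/and5P => ab by_ yz zx /and5P[xa _ ay az /and5P[ax _ bz bx _]].
have Yx : x \in private_nbrs a b by rewrite inE sedge_sym xa eq_sym.
have Zy : y \in private_nbrs b a by rewrite inE by_ eq_sym.
have rz : remote a b z.
  rewrite /remote /= eq_sym az eq_sym bz (tfG _ _ _ by_ yz) andbT /=.
  by have := tfG _ _ _ zx xa; rewrite sedge_sym.
have gcb := trace_gcb ab tfG diamG Yx Zy rz.
by do 5!eexists; split; [case: gcb | exact: gcb].
Qed.
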